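(* Let $M^2$ be a spacelike surface in $\mathbb R^4_1$ free of flat points. Then $M^2$ is a surface with flat normal connection if and only if at each point of $M^2$ the tangent indicatrix $\chi$ is a rectangular hyperbola (a Lorentz circle).
   Context: $\mathbb R^4_1$ is the four-dimensional Minkowski space with metric $\langle\,,\rangle$ of signature $(3,1)$, with a fixed orthonormal basis $e_1,e_2,e_3,e_4$, $e_1^2=e_2^2=e_3^2=1$, $e_4^2=-1$, giving the orientation. A surface $M^2: z=z(u,v)$, $(u,v)\in\mathcal D\subset\mathbb R^2$ (smooth immersion) is spacelike if the induced metric is Riemannian. Put $E=\langle z_u,z_u\rangle$, $F=\langle z_u,z_v\rangle$, $G=\langle z_v,z_v\rangle$, $W=\sqrt{EG-F^2}$. Choose a normal frame field $\{n_1,n_2\}$ with $\langle n_1,n_1\rangle=1$, $\langle n_2,n_2\rangle=-1$, $\langle n_1,n_2\rangle=0$, such that $\{z_u,z_v,n_1,n_2\}$ is positively oriented. Put $c_{11}^k=\langle z_{uu},n_k\rangle$, $c_{12}^k=\langle z_{uv},n_k\rangle$, $c_{22}^k=\langle z_{vv},n_k\rangle$ ($k=1,2$), $$\Delta_1=c_{11}^1c_{12}^2-c_{11}^2c_{12}^1,\quad \Delta_2=c_{11}^1c_{22}^2-c_{11}^2c_{22}^1,\quad \Delta_3=c_{12}^1c_{22}^2-c_{12}^2c_{22}^1,$$ $$L=\frac{2\Delta_1}{W},\quad M=\frac{\Delta_2}{W},\quad N=\frac{2\Delta_3}{W}.$$ A point is flat if $L=M=N=0$ there. For tangents $g_i$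 spanned by $\lambda_iz_u+\mu_iz_v\neq0$ put $$\zeta_{g_1,g_2}=\frac{L\lambda_1\lambda_2+M(\lambda_1\mu_2+\mu_1\lambda_2)+N\mu_1\mu_2}{\sqrt{I(\lambda_1,\mu_1)}\sqrt{I(\lambda_2,\mu_2)}},\qquad I(\lambda,\mu)=E\lambda^2+2F\lambda\mu+G\mu^2.$$ The normal curvature of $g$ is $\nu_g=\zeta_{g,g}$; $g$ is principal if $\zeta_{g,g^\bot}=0$, where $g^\bot$ is the tangent orthogonal to $g$. At every point there are two orthogonal principal tangents; their normal curvatures $\nu',\nu''$ are the principal normal curvatures (if all tangents at $p$ are principal, $\nu'=\nu''$ is the common normal curvature and any pair of orthogonal tangents may be used). The tangent indicatrix at $p$ is the curve in $T_pM^2$ $$\chi:\ \nu'X^2+\nu''Y^2=\varepsilon,\qquad \varepsilon=\pm1,$$ in coordinates $(X,Y)$ with respect to an orthonormal basis of $T_pM^2$ along principal tangents with normal curvatures $\nu',\nu''$. When $\nu'\nu''<0$, $\chi$ consists of two (conjugate) hyperbolas and is, for simplicity, called a hyperbola; it is rectangular if its two semi-axes $1/\sqrt{|\nu'|}$ and $1/\sqrt{|\nu''|}$ are equal. $M^2$ has flat normal connection if the curvature of its normal connection vanishes identically (in terms of the functions $E,F,G,L,M,N$ this curvature is $\varkappa=\frac{EN+GL-2FM}{2(EG-F^2)}$). *)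

(* Defs.v *)
From HB Require Import structures.
From mathcomp Require Import all_boot all_order all_algebra.
From mathcomp Require Import all_classical all_reals all_analysis.
Set Implicit Arguments.
Unset Strict Implicit.
Unset Printing Implicit Defensive.
Import Order.TTheory GRing.Theory Num.Theory.
Import numFieldNormedType.Exports.
Local Open Scope classical_set_scope.
Local Open Scope ring_scope.

(* Minkowski space is the space of row vectors of length 4; its fixed oriented
   orthonormal basis e_1, e_2, e_3, e_4 is the standard basis. *)
Definition lorentz_prod (R : realType) (x y : 'rV[R]_4) : R :=
  \sum_(i < 4) (if i == ord_max then -1 else 1) * x 0 i * y 0 i.

Definition positively_oriented (R : realType) (a b c d : 'rV[R]_4) : Prop :=
  0 < \det (\matrix_(i < 4) [:: a; b; c; d]`_i).

(* Partial derivatives of functions of a point p = (u, v) of the parameter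
   plane. *)
Definition eu (R : realType) : R * R := (1, 0).
Definition ev (R : realType) : R * R := (0, 1).
Definition du (R : realType) (V : normedModType R) (f : R * R -> V) :
  R * R -> V := 'D_(eu R) f.
Definition dv (R : realType) (V : normedModType R) (f : R * R -> V) :
  R * R -> V := 'D_(ev R) f.

Fixpoint Ck_on (R : realType) (V : normedModType R) (D : set (R * R))
    (k : nat) (f : R * R -> V) : Prop :=
  (forall p, D p -> {for p, continuous f}) /\
  if k is k'.+1 then
    [/\ forall p, D p -> derivable f p (eu R) /\ derivable f p (ev R),
        Ck_on D k' (du f) & Ck_on D k' (dv f)]
  else True.

Definition smooth_on (R : realType) (V : normedModType R) (D : set (R * R))
    (f : R * R -> V) : Prop :=
  forall k, Ck_on D k f.

(* A tangent vector at z(p) is represented by its coordinates t = (lambda, mu)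
   with respect to z_u, z_v; [tangent z p t] is the vector itself. *)
Definition tangent (R : realType) (z : R * R -> 'rV[R]_4) (p t : R * R) :
  'rV[R]_4 := t.1 *: du z p + t.2 *: dv z p.

Definition spacelike_surface (R : realType) (D : set (R * R))
    (z : R * R -> 'rV[R]_4) : Prop :=
  [/\ open D, smooth_on D z,
      forall p t, D p -> tangent z p t = 0 -> t = 0 (* immersion *)
    & forall p t, D p -> t != 0 ->
        0 < lorentz_prod (tangent z p t) (tangent z p t)].

Definition normal_to (R : realType) (z : R * R -> 'rV[R]_4) (p : R * R)
    (w : 'rV[R]_4) : Prop :=
  lorentz_prod w (du z p) = 0 /\ lorentz_prod w (dv z p) = 0.

Definition normal_frame (R : realType) (D : set (R * R))
    (z n1 n2 : R * R -> 'rV[R]_4) : Prop :=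
  [/\ smooth_on D n1, smooth_on D n2
    & forall p, D p ->
      [/\ normal_to z p (n1 p) /\ normal_to z p (n2 p),
          lorentz_prod (n1 p) (n1 p) = 1,
          lorentz_prod (n2 p) (n2 p) = -1,
          lorentz_prod (n1 p) (n2 p) = 0
        & positively_oriented (du z p) (dv z p) (n1 p) (n2 p)]].

Section SurfaceForms.
Context {R : realType}.
Implicit Types (z n : R * R -> 'rV[R]_4) (p g h s t : R * R).

Definition coefE z p : R := lorentz_prod (du z p) (du z p).
Definition coefF z p : R := lorentz_prod (du z p) (dv z p).
Definition coefG z p : R := lorentz_prod (dv z p) (dv z p).
Definition coefW z p : R :=
  Num.sqrt (coefE z p * coefG z p - coefF z p ^+ 2).

Definition c11 z n p : R := lorentz_prod (du (du z) p) (n p).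
Definition c12 z n p : R := lorentz_prod (dv (du z) p) (n p).
Definition c22 z n p : R := lorentz_prod (dv (dv z) p) (n p).

Definition Delta1 z n1 n2 p : R :=
  c11 z n1 p * c12 z n2 p - c11 z n2 p * c12 z n1 p.
Definition Delta2 z n1 n2 p : R :=
  c11 z n1 p * c22 z n2 p - c11 z n2 p * c22 z n1 p.
Definition Delta3 z n1 n2 p : R :=
  c12 z n1 p * c22 z n2 p - c12 z n2 p * c22 z n1 p.

Definition coefL z n1 n2 p : R := 2 * Delta1 z n1 n2 p / coefW z p.
Definition coefM z n1 n2 p : R := Delta2 z n1 n2 p / coefW z p.
Definition coefN z n1 n2 p : R := 2 * Delta3 z n1 n2 p / coefW z p.

Definition flat_point z n1 n2 p : Prop :=
  [/\ coefL z n1 n2 p = 0, coefM z n1 n2 p = 0 & coefN z n1 n2 p = 0].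

(* The first fundamental form, polarized: [fff z p g g] is I(lambda, mu). *)
Definition fff z p g h : R :=
  coefE z p * g.1 * h.1 + coefF z p * (g.1 * h.2 + g.2 * h.1)
  + coefG z p * g.2 * h.2.

Definition zeta z n1 n2 p g h : R :=
  (coefL z n1 n2 p * g.1 * h.1 + coefM z n1 n2 p * (g.1 * h.2 + g.2 * h.1)
   + coefN z n1 n2 p * g.2 * h.2)
  / (Num.sqrt (fff z p g g) * Num.sqrt (fff z p h h)).

Definition normal_curvature z n1 n2 p g : R := zeta z n1 n2 p g g.

(* h ranges over the nonzero vectors spanning the tangent orthogonal to g. *)
Definition principal z n1 n2 p g : Prop :=
  g != 0 /\ forall h, h != 0 -> fff z p g h = 0 -> zeta z n1 n2 p g h = 0.

Definition orthonormal_tangents z p s t : Prop :=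
  [/\ fff z p s s = 1, fff z p t t = 1 & fff z p s t = 0].

(* The points X s + Y t of the tangent plane with nu' X^2 + nu'' Y^2 = +-1,
   where s, t is an orthonormal basis along principal tangents with normal
   curvatures nu', nu''.  All choices of such a basis give the same curve. *)
Definition tangent_indicatrix z n1 n2 p : set (R * R) :=
  [set w | exists s t X Y,
    [/\ orthonormal_tangents z p s t,
        principal z n1 n2 p s, principal z n1 n2 p t,
        w = X *: s + Y *: t
      & let q := normal_curvature z n1 n2 p s * X ^+ 2
                 + normal_curvature z n1 n2 p t * Y ^+ 2 in
        q = 1 \/ q = -1]].

(* C is a pair of conjugate hyperbolas X^2/a^2 - Y^2/b^2 = +-1 in the tangent
   plane, for orthonormal coordinates X, Y.  For nu' X^2 + nu'' Y^2 = +-1 with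
   nu' nu'' < 0 this gives a = 1 / sqrt |nu'| and b = 1 / sqrt |nu''|. *)
Definition hyperbola z p (a b : R) (C : set (R * R)) : Prop :=
  [/\ 0 < a, 0 < b
    & exists s t, orthonormal_tangents z p s t /\
        C = [set w | exists X Y, w = X *: s + Y *: t /\
              let q := X ^+ 2 / a ^+ 2 - Y ^+ 2 / b ^+ 2 in
              q = 1 \/ q = -1]].

Definition rectangular_hyperbola z p (C : set (R * R)) : Prop :=
  exists a b, hyperbola z p a b C /\ a = b.

(* Orthogonal projections of R^4_1 onto the tangent and the normal plane; the
   first is the solution of the Gram system of z_u, z_v. *)
Definition tangential_part z p (w : 'rV[R]_4) : 'rV[R]_4 :=
  let wu := lorentz_prod w (du z p) in
  let wv := lorentz_prod w (dv z p) in
  let d := coefE z p * coefG z p - coefF z p ^+ 2 in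
  tangent z p ((coefG z p * wu - coefF z p * wv) / d,
               (coefE z p * wv - coefF z p * wu) / d).
Definition normal_part z p (w : 'rV[R]_4) : 'rV[R]_4 :=
  w - tangential_part z p w.

(* Normal connection along the coordinate fields. *)
Definition nabla_u z (xi : R * R -> 'rV[R]_4) : R * R -> 'rV[R]_4 :=
  fun p => normal_part z p (du xi p).
Definition nabla_v z (xi : R * R -> 'rV[R]_4) : R * R -> 'rV[R]_4 :=
  fun p => normal_part z p (dv xi p).

(* R^perp(z_u, z_v) xi; as [z_u, z_v] = 0 there is no bracket term, and since
   R^perp is alternating in its tangent arguments this value determines it. *)
Definition normal_curvature_tensor z (xi : R * R -> 'rV[R]_4) :
  R * R -> 'rV[R]_4 :=
  fun p => nabla_u z (nabla_v z xi) p - nabla_v z (nabla_u z xi) p.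

Definition flat_normal_connection (D : set (R * R)) z : Prop :=
  forall xi, smooth_on D xi -> (forall p, D p -> normal_to z p (xi p)) ->
  forall p, D p -> normal_curvature_tensor z xi p = 0.

End SurfaceForms.

(* Main.v *)
From Pilot Require Import Defs.
From HB Require Import structures.
From mathcomp Require Import all_boot all_order all_algebra.
From mathcomp Require Import all_classical all_reals all_analysis.
From mathcomp Require Import ring lra.
(* Re-imported so that coefE denotes the metric coefficient and not the
   polynomial multirule of the same name. *)
Import Pilot.Defs.
Set Implicit Arguments.
Unset Strict Implicit.
Unset Printing Implicit Defensive.
Import Order.TTheory GRing.Theory Num.Theory.
Import numFieldNormedType.Exports.
Local Open Scope classical_set_scope.
Local Open Scope ring_scope.

(** Both sides of the equivalence say that the quadratic form Q with
coefficients L, M, N is trace-free with respect to the first fundamental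
form I, that is, E N + G L - 2 F M = 0 at every point.

On the side of the connection, this is the Ricci equation.  Differentiating
<xi, z_u> = <xi, z_v> = 0 for a normal field xi gives the tangential parts of
xi_u and xi_v in terms of the c_ij of xi (weingarten).  In the commutator of the
covariant derivatives the second derivatives of xi cancel, because mixed
partial derivatives agree (schwarz), and only products of two c_ij survive
(ricci_equation).  The resulting expression is alternating in the two normal
arguments, so it is a multiple of its value at the pair n1, n2, which is
- W / 2 times E N + G L - 2 F M.  Since z_u, z_v, n1, n2 is a basis and the
Lorentz product is nondegenerate, the curvature tensor vanishes exactly when
this number does (flat_normal_connectionP).

On the side of the indicatrix, I and Q can be diagonalized simultaneously
(simultaneous_diagonalization).  Off-diagonal terms vanish in a principal
frame, so the indicatrix is the level set Q = 1 or Q = -1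
(tangent_indicatrixE).  In any I-orthonormal frame the trace of Q is
(E N + G L - 2 F M) / (E G - F^2) (frame_trace).  If it is zero, the
principal curvatures are opposite, and nonzero because the point is not flat,
so the level set is a rectangular hyperbola (mixed_trace_rectangular).
Conversely, four points of a rectangular hyperbola suffice to force trace zero
(rectangular_mixed_trace). *)

(** * Symmetry of mixed directional derivatives *)

Section Schwarz.
Context {R : realType} {V : normedModType R}.
Implicit Types (f : V -> R) (p q e : V).

Lemma is_derive_translate f q w e (df : R) :
  is_derive (w + q) e f df -> is_derive q e (fun x => f (w + x)) df.
Proof.
move=> [d <-].
have E : (fun h : R => h^-1 *: (((fun x => f (w + x)) \o shift q) (h *: e)
      - f (w + q)))
   = (fun h : R => h^-1 *: ((f \o shift (w + q)) (h *: e) - f (w + q))).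
  by apply/funext => h /=; rewrite addrCA.
by apply: DeriveDef; rewrite /derivable /derive E.
Qed.

Lemma is_derive_line f q e (s df : R) :
  is_derive (s *: e + q) e f df ->
  is_derive s 1 (fun t : R => f (t *: e + q)) df.
Proof.
move=> [d <-].
have E : (fun h : R => h^-1 *:
      (((fun t : R => f (t *: e + q)) \o shift s) (h *: 1) - f (s *: e + q)))
   = (fun h : R => h^-1 *:
      ((f \o shift (s *: e + q)) (h *: e) - f (s *: e + q))).
  apply/funext => h /=; rewrite addrA -scalerDl.
  by congr (_ *: (f (( _ + s) *: e + q) - _)); rewrite /GRing.scale /= mulr1.
by apply: DeriveDef; rewrite /derivable /derive E.
Qed.

Lemma mean_value_line f df q e (h : R) : 0 < h ->
  (forall s, 0 <= s <= h -> is_derive (s *: e + q) e f (df (s *: e + q))) ->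
  exists2 s, 0 <= s <= h & f (h *: e + q) - f q = df (s *: e + q) * h.
Proof.
move=> h0 dfE.
have der s : 0 <= s <= h ->
    is_derive s 1 (fun t : R => f (t *: e + q)) (df (s *: e + q)).
  by move=> /dfE; exact: is_derive_line.
have [|||s] := @MVT_segment _ (fun t : R => f (t *: e + q))
    (fun s => df (s *: e + q)) 0 h.
- exact: ltW.
- by move=> s; rewrite in_itv /= => /andP[s0 sh]; apply: der; rewrite !ltW.
- apply: derivable_within_continuous => s; rewrite in_itv /= => sh.
  by have [] := der _ sh.
rewrite in_itv /= => sh; rewrite scale0r add0r subr0 => ->.
by exists s.
Qed.

(** Two applications of the mean value theorem: the first in direction e1, to
the increment of f along e2, the second in direction e2, to f1. *)
Lemma second_difference f f1 f12 p e1 e2 (h : R) : 0 < h ->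
  (forall s t, 0 <= s <= h -> 0 <= t <= h ->
     let q := s *: e1 + (t *: e2 + p) in
     is_derive q e1 f (f1 q) /\ is_derive q e2 f1 (f12 q)) ->
  exists s t, [/\ 0 <= s <= h, 0 <= t <= h &
    f (h *: e1 + (h *: e2 + p)) - f (h *: e1 + p) - f (h *: e2 + p) + f p
    = f12 (s *: e1 + (t *: e2 + p)) * h ^+ 2].
Proof.
move=> h0 df.
have h00 : 0 <= (0 : R) <= h by rewrite lexx ltW.
have hhh : 0 <= h <= h by rewrite lexx ltW.
pose g q := f (h *: e2 + q) - f q.
pose dg q := f1 (h *: e2 + q) - f1 q.
have [|s sh E] := @mean_value_line g dg p e1 h h0.
  move=> s sh.
  have [d1 _] := df s h sh hhh; have [d0 _] := df s 0 sh h00.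
  rewrite scale0r add0r in d0; rewrite addrCA in d1.
  have d1' := is_derive_translate d1.
  exact: is_deriveB.
have [|t th Et] := @mean_value_line f1 f12 (s *: e1 + p) e2 h h0.
  by move=> t th; have [_] := df s t sh th; rewrite addrCA.
exists s, t; split => //.
move: E; rewrite /dg /g Et [s *: e1 + (_ + _)]addrCA.
by rewrite [h *: e1 + (_ + _)]addrCA expr2 mulrA => <-; ring.
Qed.

Lemma near_value (g : V -> R) p (eps : R) : 0 < eps ->
  {for p, continuous g} -> \forall q \near p, `|g p - g q| < eps.
Proof. by move=> eps0 /cvgrPdist_lt; apply. Qed.

(** The second difference over a small parallelogram at p is symmetric in e1
and e2, so by second_difference some value of f12 near p equals some value of
f21 near p, and continuity concludes.  The
derivatives are given as separate functions so that coordinates of vector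
functions fit without rewriting under a derivative. *)
Lemma schwarz (D : set V) f f1 f2 f12 f21 e1 e2 p : open D -> D p ->
  (forall q, D q -> is_derive q e1 f (f1 q)) ->
  (forall q, D q -> is_derive q e2 f (f2 q)) ->
  (forall q, D q -> is_derive q e2 f1 (f12 q)) ->
  (forall q, D q -> is_derive q e1 f2 (f21 q)) ->
  {for p, continuous f12} -> {for p, continuous f21} ->
  f12 p = f21 p.
Proof.
move=> oD Dp d1 d2 d12 d21 c12 c21.
apply/eqP; rewrite -subr_eq0 -normr_eq0 eq_le normr_ge0 andbT.
apply/ler_addgt0Pr => eps eps0; rewrite add0r.
have eps20 : 0 < eps / 2 by rewrite divr_gt0.
have : \forall q \near p,
    [/\ D q, `|f12 p - f12 q| < eps / 2 & `|f21 p - f21 q| < eps / 2].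
  have Dq : \forall q \near p, D q by exact: open_nbhs_nbhs.
  apply: filterS (filterI Dq
    (filterI (near_value eps20 c12) (near_value eps20 c21))).
  by move=> q [Hq [n12q n21q]]; exact: And3 Hq n12q n21q.
move=> /nbhs_ballP[r /= r0 ball_r].
(* The summand 1 keeps N positive when e1 = e2 = 0. *)
pose N := 1 + `|e1| + `|e2|.
have N0 : 0 < N by rewrite /N -addrA ltr_pwDl // addr_ge0.
pose h := r / 2 / N.
have h0 : 0 < h by rewrite !divr_gt0.
have near_p s t : 0 <= s <= h -> 0 <= t <= h ->
    ball p r (s *: e1 + (t *: e2 + p)).
  move=> /andP[s0 sh] /andP[t0 th].
  rewrite -ball_normE /= distrC !addrA addrK.
  apply: (le_lt_trans (ler_normD _ _)); rewrite !normrZ !ger0_norm //.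
  apply: (@le_lt_trans _ _ (h * `|e1| + h * `|e2|)).
    by rewrite lerD // ler_wpM2r.
  have : h * N = r / 2 by rewrite /h divfK // gt_eqF.
  by rewrite /N !mulrDr mulr1 => E; move: h0 r0 E; lra.
have [|s [t [sh th E]]] := @second_difference f f1 f12 p e1 e2 h h0.
  move=> s t sh th q; have [Dq _ _] := ball_r _ (near_p _ _ sh th).
  by split; [exact: d1|exact: d12].
have [|t' [s' [th' sh']]] := @second_difference f f2 f21 p e2 e1 h h0.
  move=> t' s' th' sh' q; have [Dq _ _] := ball_r _ (near_p _ _ sh' th').
  by rewrite /q addrCA; split; [exact: d2|exact: d21].
rewrite [h *: e2 + (_ + _)]addrCA [t' *: e2 + (_ + _)]addrCA.
rewrite [_ - f (h *: e2 + p) - f (h *: e1 + p)]addrAC E.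
move=> /(mulIf (lt0r_neq0 (exprn_gt0 2 h0))) E'.
have [_ q12 _] := ball_r _ (near_p _ _ sh th).
have [_ _ q21] := ball_r _ (near_p _ _ sh' th').
rewrite E' in q12.
have tri (a b c : R) : `|a - c| < eps / 2 -> `|b - c| < eps / 2 ->
    `|a - b| <= eps.
  move=> ac bc; rewrite (_ : a - b = (a - c) - (b - c)); last by ring.
  by have := ler_normB (a - c) (b - c); lra.
exact: tri q12 q21.
Qed.

End Schwarz.

(** * Simultaneous diagonalization of binary quadratic forms *)

Section BinaryForms.
Context {R : realType}.
Implicit Types (a b c x y : R) (g h s t w : R * R).

(** The symmetric bilinear form with matrix (a, b; b, c); with E, F, G it
is fff and with L, M, N it is the numerator of zeta, both by conversion. *)
Definition bform a b c g h : R :=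
  a * g.1 * h.1 + b * (g.1 * h.2 + g.2 * h.1) + c * g.2 * h.2.

Lemma bform_lincomb a b c s t x y x' y' :
  bform a b c (x *: s + y *: t) (x' *: s + y' *: t) =
  x * x' * bform a b c s s + (x * y' + y * x') * bform a b c s t
  + y * y' * bform a b c t t.
Proof. by rewrite /bform /= /GRing.scale /=; ring. Qed.

Lemma bformC a b c s t : bform a b c s t = bform a b c t s.
Proof. by rewrite /bform; ring. Qed.

Lemma bformZ a b c s t x y :
  bform a b c (x *: s) (y *: t) = x * y * bform a b c s t.
Proof. by rewrite /bform /= /GRing.scale /=; ring. Qed.

Lemma bform0l a b c h : bform a b c 0 h = 0.
Proof. by rewrite /bform /=; ring. Qed.

Lemma bform_unit_neq0 a b c s : bform a b c s s = 1 -> s != 0.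
Proof.
by move=> ss; apply/eqP => s0; move/eqP: ss; rewrite s0 bform0l eq_sym oner_eq0.
Qed.

Section Frame.
Variables (E F G : R) (s t : R * R).
Hypotheses (ss : bform E F G s s = 1) (tt : bform E F G t t = 1)
  (st : bform E F G s t = 0).

Let delta := s.1 * t.2 - s.2 * t.1.

(** The square of an area: the Gram determinant of s, t is the Gram determinant
of the coordinate basis times the squared determinant of the coordinates. *)
Lemma frame_det : (E * G - F ^+ 2) * delta ^+ 2 = 1.
Proof.
have -> : (E * G - F ^+ 2) * delta ^+ 2 =
    bform E F G s s * bform E F G t t - bform E F G s t ^+ 2.
  by rewrite /bform /delta; ring.
by rewrite ss tt st; ring.
Qed.

Lemma frame_span w : exists x y, w = x *: s + y *: t.
Proof.
have d0 : delta != 0.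
  apply/eqP => d0; have := frame_det; rewrite d0 expr0n mulr0 => /eqP.
  by rewrite eq_sym oner_eq0.
exists ((w.1 * t.2 - w.2 * t.1) / delta), ((s.1 * w.2 - s.2 * w.1) / delta).
by apply: injective_projections; rewrite /= /GRing.scale /=;
  move: d0; rewrite /delta => d0; field.
Qed.

(** By polarization of the Gram identity frame_det, delta^2 times the left-hand
side is a combination of the values of both forms on s, t in which only the
trace remains for an orthonormal frame. *)
Lemma frame_trace L M N :
  E * N + G * L - 2 * F * M =
  (E * G - F ^+ 2) * (bform L M N s s + bform L M N t t).
Proof.
have -> : bform L M N s s + bform L M N t t =
    delta ^+ 2 * (E * N + G * L - 2 * F * M).
  transitivity (bform L M N s s * bform E F G t t
    + bform L M N t t * bform E F G s s
    - 2 * bform L M N s t * bform E F G s t); first by rewrite ss tt st; ring.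
  by rewrite /bform /delta; ring.
by rewrite mulrA frame_det mul1r.
Qed.

End Frame.

Lemma quadratic_isotropic a b c : 0 <= b ^+ 2 - 4 * a * c ->
  exists2 s, s != 0 & a * s.1 ^+ 2 + b * s.1 * s.2 + c * s.2 ^+ 2 = 0.
Proof.
move=> disc; have [->|a0] := eqVneq a 0.
  exists (1, 0); last by rewrite /=; ring.
  by apply/eqP => -[/eqP]; rewrite oner_eq0.
exists ((- b + Num.sqrt (b ^+ 2 - 4 * a * c)) / (2 * a), 1).
  by apply/eqP => -[_ /eqP]; rewrite oner_eq0.
have := sqr_sqrtr disc; set r := Num.sqrt _ => rE /=.
have -> : a * ((- b + r) / (2 * a)) ^+ 2 + b * ((- b + r) / (2 * a)) * 1
    + c * 1 ^+ 2 = (r ^+ 2 - (b ^+ 2 - 4 * a * c)) / (4 * a) by field.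
by rewrite rE subrr mul0r.
Qed.

(** Let t be s rotated by a right angle in the metric I.  Then Q (s, t) is a
binary quadratic form in s with coefficients a, b, c.  The relation
a G - b F + c E = 0 makes its discriminant a sum of two nonnegative terms, so
it has an isotropic vector s. *)
Lemma simultaneous_diagonalization E F G L M N :
  0 < E -> 0 < E * G - F ^+ 2 ->
  (forall g, g != 0 -> 0 < bform E F G g g) ->
  exists s t, [/\ bform E F G s s = 1, bform E F G t t = 1,
    bform E F G s t = 0 & bform L M N s t = 0].
Proof.
move=> E0 d0 Ipos.
pose a := M * E - L * F; pose b := N * E - L * G; pose c := N * F - M * G.
have [|s s0 sE] := @quadratic_isotropic a b c.
  have -> : b ^+ 2 - 4 * a * c =
      (b - 2 * a * F / E) ^+ 2 + 4 * (a / E) ^+ 2 * (E * G - F ^+ 2).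
    by rewrite /a /b /c; field; rewrite gt_eqF.
  exact: addr_ge0 (sqr_ge0 _)
    (mulr_ge0 (mulr_ge0 (ler0n _ 4) (sqr_ge0 _)) (ltW d0)).
pose t : R * R := (- (F * s.1 + G * s.2), E * s.1 + F * s.2).
have st : bform E F G s t = 0 by rewrite /bform /=; ring.
have Qst : bform L M N s t = 0.
  by rewrite -sE /bform /= /a /b /c; ring.
have Is := Ipos _ s0.
have It : 0 < bform E F G t t.
  have -> : bform E F G t t = (E * G - F ^+ 2) * bform E F G s s.
    by rewrite /bform /=; ring.
  exact: mulr_gt0.
exists ((Num.sqrt (bform E F G s s))^-1 *: s),
  ((Num.sqrt (bform E F G t t))^-1 *: t).
have unit x : 0 < x -> (Num.sqrt x)^-1 * (Num.sqrt x)^-1 * x = 1.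
  move=> x0; rewrite -{3}(sqr_sqrtr (ltW x0)); field.
  by rewrite gt_eqF // sqrtr_gt0.
by rewrite !bformZ !unit // st Qst !mulr0.
Qed.

End BinaryForms.

(** * The Lorentz product *)

Section Lorentz.
Context {R : realType}.
Implicit Types (x y w a b c d : 'rV[R]_4) (k : R).

Lemma lorentzC x y : lorentz_prod x y = lorentz_prod y x.
Proof. by apply: eq_bigr => i _; ring. Qed.

Lemma lorentzDl x y w :
  lorentz_prod (x + y) w = lorentz_prod x w + lorentz_prod y w.
Proof. by rewrite -big_split; apply: eq_bigr => i _; rewrite /= mxE; ring. Qed.

Lemma lorentzZl k x w : lorentz_prod (k *: x) w = k * lorentz_prod x w.
Proof. by rewrite big_distrr; apply: eq_bigr => i _; rewrite /= mxE; ring. Qed.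

Lemma lorentzBl x y w :
  lorentz_prod (x - y) w = lorentz_prod x w - lorentz_prod y w.
Proof. by rewrite -scaleN1r lorentzDl lorentzZl mulN1r. Qed.

Lemma lorentzDr x y w :
  lorentz_prod w (x + y) = lorentz_prod w x + lorentz_prod w y.
Proof. by rewrite lorentzC lorentzDl !(lorentzC w). Qed.

Lemma lorentzZr k x w : lorentz_prod w (k *: x) = k * lorentz_prod w x.
Proof. by rewrite lorentzC lorentzZl (lorentzC w). Qed.

(** The four products are the entries of the invertible matrix with rows
a, b, c, d applied to w with its last coordinate negated. *)
Lemma lorentz_nondegenerate a b c d w : positively_oriented a b c d ->
  lorentz_prod w a = 0 -> lorentz_prod w b = 0 ->
  lorentz_prod w c = 0 -> lorentz_prod w d = 0 -> w = 0.
Proof.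
move=> detA wa wb wc wd.
pose A := \matrix_(i < 4) [:: a; b; c; d]`_i : 'M[R]_4.
pose sg (i : 'I_4) : R := if i == ord_max then -1 else 1.
pose v : 'cV[R]_4 := \col_i (sg i * w 0 i).
have uA : A \in unitmx by rewrite unitmxE unitfE gt_eqF.
have row_v (i : 'I_4) : (A *m v) i 0 = lorentz_prod w [:: a; b; c; d]`_i.
  by rewrite mxE; apply: eq_bigr => j _; rewrite !mxE -/(sg j) mulrC.
have Av : A *m v = 0.
  apply/colP => i; rewrite row_v [RHS]mxE.
  by case: i => -[|[|[|[|//]]]] /= _.
have v0 : v = 0 by rewrite -(mulKmx uA v) Av mulmx0.
apply/rowP => i; have /colP/(_ i) := v0; rewrite !mxE /sg => /eqP.
by rewrite mulf_eq0; case: ifP => _; rewrite ?oppr_eq0 oner_eq0 => /eqP.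
Qed.

End Lorentz.

(** * Derivatives of vector-valued functions *)

Section VectorValued.
Context {R : realType} {V : normedModType R}.
Implicit Types (p v : V).

Lemma is_derive_coord n (f : V -> 'rV[R]_n) p v (df : 'rV[R]_n) :
  is_derive p v f df <-> forall i, is_derive p v (fun q => f q 0 i) (df 0 i).
Proof.
split=> [[d <-] i|d].
  have di := (derivable_mxP f p v).1 d 0 i.
  by apply: DeriveDef => //; rewrite derive_mx // mxE.
have d' : derivable f p v.
  by apply/derivable_mxP => i j; rewrite (ord1 i); have [] := d j.
apply: DeriveDef => //; rewrite derive_mx //.
by apply/rowP => j; rewrite mxE; have [] := d j.
Qed.

Lemma is_derive_scaler n (a : V -> R) (x : V -> 'rV[R]_n) p v da dx :
  is_derive p v a da -> is_derive p v x dx ->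
  is_derive p v (fun q => a q *: x q) (da *: x p + a p *: dx).
Proof.
move=> Ha /is_derive_coord Hx; apply/is_derive_coord => i.
rewrite (_ : (fun q => _) = a * (fun q => x q 0 i)); last first.
  by apply/funext => q; rewrite mxE.
have Hxi := Hx i.
apply: (@is_derive_eq _ _ _ _ _ _ _ _ (is_deriveM Ha Hxi)).
by rewrite !mxE addrC /GRing.scale /= [da * _]mulrC.
Qed.

Lemma is_derive_lorentz (x y : V -> 'rV[R]_4) p v dx dy :
  is_derive p v x dx -> is_derive p v y dy ->
  is_derive p v (fun q => lorentz_prod (x q) (y q))
    (lorentz_prod dx (y p) + lorentz_prod (x p) dy).
Proof.
move=> /is_derive_coord Hx /is_derive_coord Hy.
pose c (i : 'I_4) : R := if i == ord_max then -1 else 1.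
pose g i : V -> R := c i *: ((fun q => x q 0 i) * (fun q => y q 0 i)).
rewrite (_ : (fun q => _) = \sum_(i < 4) g i); last first.
  apply/funext => q; rewrite fct_sumE; apply: eq_bigr => i _.
  by rewrite -mulrA.
have dg i : is_derive p v (g i)
    (c i *: (x p 0 i *: dy 0 i + y p 0 i *: dx 0 i)).
  by apply: is_deriveZ; apply: is_deriveM.
apply: is_derive_eq (is_derive_sum dg) _.
rewrite /lorentz_prod -big_split /=; apply: eq_bigr => i _.
by rewrite /GRing.scale /= -/(c i); ring.
Qed.

End VectorValued.

Section Smooth.
Context {R : realType} {V : normedModType R}.
Variable D : set (R * R).
Implicit Types (f : R * R -> V) (p : R * R).

Lemma smooth_du f : smooth_on D f -> smooth_on D (du f).
Proof. by move=> sf k; have [_ []] := sf k.+1. Qed.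

Lemma smooth_dv f : smooth_on D f -> smooth_on D (dv f).
Proof. by move=> sf k; have [_ []] := sf k.+1. Qed.

Lemma smooth_is_derive_u f p : smooth_on D f -> D p ->
  is_derive p (eu R) f (du f p).
Proof.
move=> sf Dp; have [_ [df _ _]] := sf 1%N.
by have [d _] := df _ Dp; exact: DeriveDef.
Qed.

Lemma smooth_is_derive_v f p : smooth_on D f -> D p ->
  is_derive p (ev R) f (dv f p).
Proof.
move=> sf Dp; have [_ [df _ _]] := sf 1%N.
by have [_ d] := df _ Dp; exact: DeriveDef.
Qed.

Lemma smooth_continuous f p : smooth_on D f -> D p -> {for p, continuous f}.
Proof. by move=> sf Dp; have [cf _] := sf 0%N; exact: cf. Qed.

End Smooth.

Section SmoothVector.
Context {R : realType}.
Variable D : set (R * R).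
Hypothesis oD : open D.
Implicit Types (f x y : R * R -> 'rV[R]_4) (p e : R * R).

Lemma mixed_partials f p : smooth_on D f -> D p -> du (dv f) p = dv (du f) p.
Proof.
move=> sf Dp; apply/rowP => i; apply/esym.
have su := smooth_du sf; have sv := smooth_dv sf.
have coord_cont (g : R * R -> 'rV[R]_4) : smooth_on D g ->
    {for p, continuous (fun q => g q 0 i)}.
  move=> sg; apply: (@continuous_comp _ _ _ g (fun M : 'rV[R]_4 => M 0 i)).
    exact: smooth_continuous sg Dp.
  exact: coord_continuous.
apply: (@schwarz _ _ D (fun q => f q 0 i) (fun q => du f q 0 i)
  (fun q => dv f q 0 i) (fun q => dv (du f) q 0 i) (fun q => du (dv f) q 0 i)
  (eu R) (ev R) p oD Dp).
- move=> q Dq; apply: (is_derive_coord _ _ _ _).1.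
  exact: smooth_is_derive_u sf Dq.
- move=> q Dq; apply: (is_derive_coord _ _ _ _).1.
  exact: smooth_is_derive_v sf Dq.
- move=> q Dq; apply: (is_derive_coord _ _ _ _).1.
  exact: smooth_is_derive_v su Dq.
- move=> q Dq; apply: (is_derive_coord _ _ _ _).1.
  exact: smooth_is_derive_u sv Dq.
- by apply: coord_cont; exact: smooth_dv.
- by apply: coord_cont; exact: smooth_du.
Qed.

(** Differentiate <x, y> = 0; openness of D makes the identity hold in a
neighbourhood of p.  With x a normal field and y = z_u or z_v this moves a
derivative from the normal field to the surface. *)
Lemma weingarten x y p e dx dy : D p ->
  (forall q, D q -> lorentz_prod (x q) (y q) = 0) ->
  is_derive p e x dx -> is_derive p e y dy ->
  lorentz_prod dx (y p) = - lorentz_prod dy (x p).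
Proof.
move=> Dp xy0 Dx Dy; have dxy := is_derive_lorentz Dx Dy.
have near0 : \forall q \near p, lorentz_prod (x q) (y q) = cst (0 : R) q.
  by apply: filterS (open_nbhs_nbhs (conj oD Dp)) => q Dq; exact: xy0.
have [_] := near_eq_is_derive near0 dxy.
by rewrite derive_cst (lorentzC dy) => /esym/addr0_eq <-; rewrite opprK.
Qed.

End SmoothVector.

(** * Normal parts and the Ricci equation *)

Section NormalPart.
Context {R : realType}.
Implicit Types (z w : R * R -> 'rV[R]_4) (p e : R * R).

Definition gram z p : R := coefE z p * coefG z p - coefF z p ^+ 2.

(** The coordinates of the tangential part with respect to z_u, z_v,
isolated because the curvature involves their values but no derivatives. *)
Definition tangential_coef z p (w : 'rV[R]_4) : R * R :=
  ((coefG z p * lorentz_prod w (du z p)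
      - coefF z p * lorentz_prod w (dv z p)) / gram z p,
   (coefE z p * lorentz_prod w (dv z p)
      - coefF z p * lorentz_prod w (du z p)) / gram z p).

Lemma lorentz_tangent z p (g h : R * R) :
  lorentz_prod (tangent z p g) (tangent z p h) = fff z p g h.
Proof.
rewrite /fff /coefE /coefF /coefG /tangent; move: (du z p) (dv z p) => a b.
by rewrite !(lorentzDl, lorentzDr, lorentzZl, lorentzZr) (lorentzC b a); ring.
Qed.

Lemma normal_part_normal z p (w : 'rV[R]_4) : gram z p != 0 ->
  normal_to z p (normal_part z p w).
Proof.
rewrite /gram /normal_to /normal_part /tangential_part /tangent.
rewrite /coefE /coefF /coefG; move: (du z p) (dv z p) => a b d0 /=.
rewrite !(lorentzBl, lorentzDl, lorentzZl) (lorentzC b a).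
by split; field.
Qed.

Lemma lorentz_normal_part z p (w n : 'rV[R]_4) : normal_to z p n ->
  lorentz_prod (normal_part z p w) n = lorentz_prod w n.
Proof.
rewrite /normal_part.
rewrite -[tangential_part z p w]/(tangent z p (tangential_coef z p w)).
rewrite /normal_to /tangent; move: (tangential_coef z p w) => [k l] /=.
move: (du z p) (dv z p) => a b [na nb].
by rewrite lorentzBl lorentzDl !lorentzZl !(lorentzC _ n) na nb; ring.
Qed.

Section Derivative.
Variables (z w : R * R -> 'rV[R]_4) (p e : R * R) (zue zve dw : 'rV[R]_4).
Hypotheses (gram0 : gram z p != 0)
  (Du : is_derive p e (du z) zue) (Dv : is_derive p e (dv z) zve)
  (Dw : is_derive p e w dw).

Lemma is_derive_tangential_coef : exists k l,
  is_derive p e (fun q => (tangential_coef z q (w q)).1) k /\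
  is_derive p e (fun q => (tangential_coef z q (w q)).2) l.
Proof.
have dl x y dx dy : is_derive p e x dx -> is_derive p e y dy ->
    derivable (fun q => lorentz_prod (x q) (y q) : R) p e.
  by move=> Dx Dy; have [] := is_derive_lorentz Dx Dy.
have dE : derivable (coefE z) p e by exact: dl Du Du.
have dF : derivable (coefF z) p e by exact: dl Du Dv.
have dG : derivable (coefG z) p e by exact: dl Dv Dv.
have dwu := dl _ _ _ _ Dw Du; have dwv := dl _ _ _ _ Dw Dv.
have dg : derivable (gram z) p e.
  exact: (derivableB (derivableM dE dG) (derivableM dF dF)).
have dgV : derivable (fun q => (gram z q)^-1) p e := derivableV gram0 dg.
do 2 eexists; split; apply: derivableP.
- exact: (derivableM (derivableB (derivableM dG dwu) (derivableM dF dwv)) dgV).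
- exact: (derivableM (derivableB (derivableM dE dwv) (derivableM dF dwu)) dgV).
Qed.

(** The derivatives of the tangential coordinates multiply z_u and z_v, which
are orthogonal to n, so they drop out and only zue and zve contribute. *)
Lemma lorentz_derive_normal_part n : normal_to z p n ->
  lorentz_prod ('D_e (fun q => normal_part z q (w q)) p) n =
  lorentz_prod dw n
  - (tangential_coef z p (w p)).1 * lorentz_prod zue n
  - (tangential_coef z p (w p)).2 * lorentz_prod zve n.
Proof.
move=> nn; have [k [l [d1 d2]]] := is_derive_tangential_coef.
have [_ ->] :=
  is_deriveB Dw (is_deriveD (is_derive_scaler d1 Du) (is_derive_scaler d2 Dv)).
move: nn; rewrite /normal_to; move: (tangential_coef z p (w p)) => [A B] /=.
move: (du z p) (dv z p) => a b [na nb].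
by rewrite lorentzBl !lorentzDl !lorentzZl !(lorentzC _ n) na nb; ring.
Qed.

End Derivative.
End NormalPart.

Section Surface.
Context {R : realType}.
Variables (D : set (R * R)) (z : R * R -> 'rV[R]_4).
Hypothesis hz : spacelike_surface D z.
Implicit Types (p t : R * R) (xi n : R * R -> 'rV[R]_4).

Lemma fff_gt0 p t : D p -> t != 0 -> 0 < fff z p t t.
Proof.
by move=> Dp t0; have [_ _ _ pos] := hz; rewrite -lorentz_tangent; exact: pos.
Qed.

Lemma coefE_gt0 p : D p -> 0 < coefE z p.
Proof.
move=> Dp; have t0 : ((1, 0) : R * R) != 0.
  by apply/eqP => -[/eqP]; rewrite oner_eq0.
have := fff_gt0 Dp t0; rewrite /fff /=.
by rewrite !(mulr0, mulr1, mul0r, addr0).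
Qed.

Lemma gram_gt0 p : D p -> 0 < gram z p.
Proof.
move=> Dp; have E0 := coefE_gt0 Dp.
(* The tangent vector orthogonal to z_u has squared length E (E G - F^2). *)
have t0 : (- coefF z p, coefE z p) != 0.
  by apply/eqP => -[_ /eqP]; rewrite gt_eqF.
have := fff_gt0 Dp t0.
have -> : fff z p (- coefF z p, coefE z p) (- coefF z p, coefE z p) =
    coefE z p * gram z p by rewrite /fff /gram /=; ring.
by rewrite pmulr_rgt0.
Qed.

Lemma tangential_coefE p (w : 'rV[R]_4) wu wv :
  lorentz_prod w (du z p) = wu -> lorentz_prod w (dv z p) = wv ->
  tangential_coef z p w = ((coefG z p * wu - coefF z p * wv) / gram z p,
                           (coefE z p * wv - coefF z p * wu) / gram z p).
Proof. by move=> <- <-. Qed.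

(** The commutator leaves the second fundamental forms of xi and n: by
lorentz_derive_normal_part the terms xi_uv and xi_vu cancel, and by weingarten
the tangential coordinates of xi_u, xi_v are linear in the c_ij of xi.  The
product c12 c12 cancels in the coefficient of F. *)
Lemma ricci_equation xi n p : smooth_on D xi ->
  (forall q, D q -> normal_to z q (xi q)) -> normal_to z p (n p) -> D p ->
  gram z p * lorentz_prod (normal_curvature_tensor z xi p) (n p) =
  coefG z p * (c12 z xi p * c11 z n p - c11 z xi p * c12 z n p)
  + coefE z p * (c22 z xi p * c12 z n p - c12 z xi p * c22 z n p)
  - coefF z p * (c22 z xi p * c11 z n p - c11 z xi p * c22 z n p).
Proof.
move=> sxi nxi nn Dp; have [oD sz _ _] := hz.
have g0 : gram z p != 0 by rewrite gt_eqF // gram_gt0.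
have su := smooth_du sz; have sv := smooth_dv sz.
have sxu := smooth_du sxi; have sxv := smooth_dv sxi.
have Dxu := smooth_is_derive_u sxi Dp; have Dxv := smooth_is_derive_v sxi Dp.
have Dxvu := smooth_is_derive_u sxv Dp; have Dxuv := smooth_is_derive_v sxu Dp.
have Duu := smooth_is_derive_u su Dp; have Duv := smooth_is_derive_v su Dp.
have Dvu := smooth_is_derive_u sv Dp; have Dvv := smooth_is_derive_v sv Dp.
rewrite (mixed_partials oD sz Dp) in Dvu.
rewrite (mixed_partials oD sxi Dp) in Dxvu.
have nu q : D q -> lorentz_prod (xi q) (du z q) = 0 by case/nxi.
have nv q : D q -> lorentz_prod (xi q) (dv z q) = 0 by case/nxi.
have xuu : lorentz_prod (du xi p) (du z p) = - c11 z xi p.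
  exact: (weingarten oD Dp nu Dxu Duu).
have xuv : lorentz_prod (du xi p) (dv z p) = - c12 z xi p.
  exact: (weingarten oD Dp nv Dxu Dvu).
have xvu : lorentz_prod (dv xi p) (du z p) = - c12 z xi p.
  exact: (weingarten oD Dp nu Dxv Duv).
have xvv : lorentz_prod (dv xi p) (dv z p) = - c22 z xi p.
  exact: (weingarten oD Dp nv Dxv Dvv).
have Ruv : lorentz_prod (nabla_u z (nabla_v z xi) p) (n p) =
    lorentz_prod (dv (du xi) p) (n p)
    - (tangential_coef z p (dv xi p)).1 * c11 z n p
    - (tangential_coef z p (dv xi p)).2 * c12 z n p.
  exact: etrans (lorentz_normal_part _ nn)
    (lorentz_derive_normal_part g0 Duu Dvu Dxvu nn).
have Rvu : lorentz_prod (nabla_v z (nabla_u z xi) p) (n p) =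
    lorentz_prod (dv (du xi) p) (n p)
    - (tangential_coef z p (du xi p)).1 * c12 z n p
    - (tangential_coef z p (du xi p)).2 * c22 z n p.
  exact: etrans (lorentz_normal_part _ nn)
    (lorentz_derive_normal_part g0 Duv Dvv Dxuv nn).
have R_uv : lorentz_prod (normal_curvature_tensor z xi p) (n p) =
    lorentz_prod (nabla_u z (nabla_v z xi) p) (n p)
    - lorentz_prod (nabla_v z (nabla_u z xi) p) (n p) := lorentzBl _ _ _.
rewrite (tangential_coefE xuu xuv) /= in Rvu.
rewrite (tangential_coefE xvu xvv) /= in Ruv.
have RE := etrans R_uv (f_equal2 (fun r r' => r - r') Ruv Rvu).
apply: (etrans (congr1 _ RE)).
move: (gram z p) g0 (coefE z p) (coefF z p) (coefG z p) => d d0 E F G.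
move: (c11 z xi p) (c12 z xi p) (c22 z xi p) => x11 x12 x22.
move: (c11 z n p) (c12 z n p) (c22 z n p) (lorentz_prod _ _) => y11 y12 y22 y.
by field.
Qed.

End Surface.

Section FlatConnection.
Context {R : realType}.
Variables (D : set (R * R)) (z n1 n2 : R * R -> 'rV[R]_4).
Hypotheses (hz : spacelike_surface D z) (hn : normal_frame D z n1 n2).
Implicit Types (p : R * R) (w : 'rV[R]_4).

Lemma orthonormal_decomposition (a b c d w : 'rV[R]_4) :
  positively_oriented a b c d ->
  lorentz_prod c a = 0 -> lorentz_prod c b = 0 ->
  lorentz_prod d a = 0 -> lorentz_prod d b = 0 ->
  lorentz_prod c c = 1 -> lorentz_prod d d = -1 -> lorentz_prod c d = 0 ->
  lorentz_prod w a = 0 -> lorentz_prod w b = 0 ->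
  w = lorentz_prod w c *: c + (- lorentz_prod w d) *: d.
Proof.
move=> or ca cb da db cc dd cd wa wb; apply/eqP; rewrite -subr_eq0; apply/eqP.
apply: (lorentz_nondegenerate or);
  rewrite lorentzBl lorentzDl !lorentzZl ?ca ?cb ?da ?db ?wa ?wb ?cc ?dd
    ?(lorentzC d c) ?cd; ring.
Qed.

(** Twice E G - F^2 times the curvature of the normal connection, and also
E G - F^2 times the trace of (L, M, N) with respect to (E, F, G). *)
Definition mixed_trace p : R :=
  coefE z p * coefN z n1 n2 p + coefG z p * coefL z n1 n2 p
  - 2 * coefF z p * coefM z n1 n2 p.

(** The left-hand side is what the Ricci equation gives for the pair n1, n2, up
to sign. *)
Lemma mixed_traceE p : D p ->
  coefG z p * Delta1 z n1 n2 p + coefE z p * Delta3 z n1 n2 p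
  - coefF z p * Delta2 z n1 n2 p = coefW z p / 2 * mixed_trace p.
Proof.
move=> Dp; rewrite /mixed_trace /coefL /coefM /coefN.
have : coefW z p != 0 by rewrite gt_eqF // sqrtr_gt0; exact: (gram_gt0 hz Dp).
by move: (coefW z p) => W W0; field.
Qed.

Lemma curvature_tensor_normal xi p : D p ->
  normal_to z p (normal_curvature_tensor z xi p).
Proof.
move=> Dp; have g0 : gram z p != 0 by rewrite gt_eqF // (gram_gt0 hz).
have [uu uv] := normal_part_normal (du (nabla_v z xi) p) g0.
have [vu vv] := normal_part_normal (dv (nabla_u z xi) p) g0.
split; apply: (etrans (lorentzBl _ _ _)).
- by apply: (etrans (f_equal2 (fun r r' => r - r') uu vu)); rewrite subrr.
- by apply: (etrans (f_equal2 (fun r r' => r - r') uv vv)); rewrite subrr.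
Qed.

(** One direction applies the Ricci equation to xi = n1 and n = n2.  For the
other, xi = k n1 + l n2 at p, and since the Ricci expression is alternating,
its values at (xi, n1) and (xi, n2) are l and - k times the vanishing value
at (n1, n2) up to sign. *)
Lemma flat_normal_connectionP :
  flat_normal_connection D z <-> (forall p, D p -> mixed_trace p = 0).
Proof.
have [s1 s2 frame] := hn.
have normal1 q : D q -> normal_to z q (n1 q) by case/frame=> -[].
split=> [flat p Dp|tr0 xi sxi nxi p Dp].
  have [[nn1 nn2] _ _ _ _] := frame p Dp.
  have := ricci_equation hz s1 normal1 nn2 Dp.
  rewrite (flat _ s1 normal1 _ Dp) -[0](scale0r (n1 p)) lorentzZl mul0r mulr0.
  move=> K; have := mixed_traceE Dp; rewrite /Delta1 /Delta2 /Delta3.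
  have W0 : coefW z p / 2 != 0.
    by rewrite gt_eqF // divr_gt0 // sqrtr_gt0; exact: (gram_gt0 hz Dp).
  move=> E; apply: (mulfI W0); rewrite -E mulr0 -[RHS]oppr0 K.
  by move: (c11 z n1 p) (c12 z n1 p) => *; ring.
have [[nn1 nn2] n11 n22 n12 or] := frame p Dp.
have g0 : gram z p != 0 by rewrite gt_eqF // (gram_gt0 hz).
have K : coefG z p * Delta1 z n1 n2 p + coefE z p * Delta3 z n1 n2 p
  - coefF z p * Delta2 z n1 n2 p = 0 by rewrite mixed_traceE // tr0 // mulr0.
have R1 := ricci_equation hz sxi nxi nn1 Dp.
have R2 := ricci_equation hz sxi nxi nn2 Dp.
have xiE : xi p = _ := orthonormal_decomposition or nn1.1 nn1.2 nn2.1 nn2.2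
  n11 n22 n12 (nxi _ Dp).1 (nxi _ Dp).2.
move: (lorentz_prod (xi p) (n1 p)) (- lorentz_prod (xi p) (n2 p)) xiE.
move=> k l xiE.
have cE w : lorentz_prod w (xi p) =
    k * lorentz_prod w (n1 p) + l * lorentz_prod w (n2 p).
  by rewrite xiE lorentzDr !lorentzZr.
have c11E : c11 z xi p = k * c11 z n1 p + l * c11 z n2 p := cE _.
have c12E : c12 z xi p = k * c12 z n1 p + l * c12 z n2 p := cE _.
have c22E : c22 z xi p = k * c22 z n1 p + l * c22 z n2 p := cE _.
have [ru rv] := curvature_tensor_normal xi Dp.
apply: (lorentz_nondegenerate or) => //; apply: (mulfI g0); rewrite mulr0.
- apply: (etrans R1); rewrite c11E c12E c22E -[RHS](mulr0 l) -K.
  by rewrite /Delta1 /Delta2 /Delta3; ring.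
- apply: (etrans R2); rewrite c11E c12E c22E -[RHS](mulr0 (- k)) -K.
  by rewrite /Delta1 /Delta2 /Delta3; ring.
Qed.

End FlatConnection.

(** * The tangent indicatrix *)

Section Indicatrix.
Context {R : realType}.
Variables (D : set (R * R)) (z n1 n2 : R * R -> 'rV[R]_4) (p : R * R).
Hypotheses (hz : spacelike_surface D z) (Dp : D p).
Implicit Types (g h s t w : R * R).

Let I := bform (coefE z p) (coefF z p) (coefG z p).
Let Q := bform (coefL z n1 n2 p) (coefM z n1 n2 p) (coefN z n1 n2 p).

Lemma normal_curvature_unit s : I s s = 1 ->
  normal_curvature z n1 n2 p s = Q s s.
Proof.
move=> ss; rewrite /normal_curvature /zeta -/(Q s s) -/(fff z p s s).
by rewrite [fff z p s s]ss sqrtr1 mulr1 divr1.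
Qed.

(** For a unit s, the vectors orthogonal to s are the multiples of t, so the
condition on all h reduces to the single vector t. *)
Lemma principal_frame s t : orthonormal_tangents z p s t ->
  principal z n1 n2 p s <-> Q s t = 0.
Proof.
move=> [ss tt st]; split=> [[_ ps]|st0].
  have t0 : t != 0 := bform_unit_neq0 tt.
  have := ps t t0 st; rewrite /zeta -/(Q s t) ss tt sqrtr1 mulr1 divr1; exact.
split; first exact: bform_unit_neq0 ss.
move=> h _ sh; have [x [y hE]] := frame_span ss tt st h.
have lin a b c : bform a b c s h = x * bform a b c s s + y * bform a b c s t.
  by rewrite hE; have := bform_lincomb a b c s t 1 0 x y;
    rewrite scale1r scale0r addr0 => ->; ring.
have x0 : x = 0.
  move: sh; rewrite -[fff z p s h]/(I s h) /I lin.
  by rewrite [bform _ _ _ s s]ss [bform _ _ _ s t]st mulr1 mulr0 addr0.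
rewrite /zeta -[_ + _ + _]/(Q s h) /Q lin x0 -/Q.
by rewrite st0 mul0r mulr0 addr0 mul0r.
Qed.

Lemma exists_principal_frame : exists s t,
  orthonormal_tangents z p s t /\ Q s t = 0.
Proof.
have [|s [t [ss tt st st0]]] := @simultaneous_diagonalization _ (coefE z p)
  (coefF z p) (coefG z p) (coefL z n1 n2 p) (coefM z n1 n2 p) (coefN z n1 n2 p)
  (coefE_gt0 hz Dp) (gram_gt0 hz Dp).
  by move=> g g0; exact: (fff_gt0 hz Dp g0).
by exists s, t.
Qed.

(** In a principal frame Q is diagonal with the principal normal curvatures as
entries.  Hence every admissible frame gives the same curve. *)
Lemma tangent_indicatrixE :
  tangent_indicatrix z n1 n2 p = [set w | Q w w = 1 \/ Q w w = -1].
Proof.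
apply/seteqP; split=> w /=.
  move=> [s [t [x [y [frame ps pt wE]]]]]; have [ss tt _] := frame.
  rewrite !normal_curvature_unit // => q.
  have -> : Q w w = Q s s * x ^+ 2 + Q t t * y ^+ 2; last exact: q.
  have st0 := (principal_frame frame).1 ps.
  by rewrite wE /Q bform_lincomb -/Q st0; ring.
move=> q; have [s [t [frame st0]]] := exists_principal_frame.
have [ss tt st] := frame.
have frame' : orthonormal_tangents z p t s.
  by split=> //; rewrite -st; exact: bformC.
have [x [y wE]] := frame_span ss tt st w.
exists s, t, x, y; split=> //.
- exact/(principal_frame frame).
- by apply/(principal_frame frame'); rewrite /Q bformC.
rewrite /= !normal_curvature_unit //.
have <- : Q w w = Q s s * x ^+ 2 + Q t t * y ^+ 2; last exact: q.
by rewrite wE /Q bform_lincomb -/Q st0; ring.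
Qed.

(** With semi-axes a, the points a (1, 0) and a (0, 1) give a^2 Q s s and
a^2 Q t t in {1, -1}; two further points exclude equal signs. *)
Lemma rectangular_mixed_trace :
  rectangular_hyperbola z p [set w | Q w w = 1 \/ Q w w = -1] ->
  mixed_trace z n1 n2 p = 0.
Proof.
move=> [a [b [[a0 _ [s [t [[ss tt st] CE]]]] ab]]]; rewrite -ab in CE.
have a20 : a ^+ 2 != 0 by rewrite expf_neq0 // gt_eqF.
have on x y : x ^+ 2 - y ^+ 2 = 1 \/ x ^+ 2 - y ^+ 2 = -1 ->
    let q := a ^+ 2 * Q s s * x ^+ 2 + 2 * (a ^+ 2 * Q s t) * x * y
             + a ^+ 2 * Q t t * y ^+ 2 in
    q = 1 \/ q = -1.
  move=> xy q.
  have : [set w | Q w w = 1 \/ Q w w = -1] ((a * x) *: s + (a * y) *: t).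
    rewrite CE /=; exists (a * x), (a * y); split=> //.
    have -> : (a * x) ^+ 2 / a ^+ 2 - (a * y) ^+ 2 / a ^+ 2 = x ^+ 2 - y ^+ 2.
      by field; rewrite gt_eqF.
    exact: xy.
  set w := _ + _; have -> // : q = Q w w.
  by rewrite /q /w /Q bform_lincomb; ring.
have q10 : a ^+ 2 * Q s s = 1 \/ a ^+ 2 * Q s s = -1.
  have := on 1 0; rewrite /= !(mulr0, expr0n, addr0, subr0, expr1n, mulr1) /=.
  by apply; left.
have q01 : a ^+ 2 * Q t t = 1 \/ a ^+ 2 * Q t t = -1.
  have := on 0 1.
  rewrite /= !(mulr0, mul0r, expr0n, add0r, sub0r, expr1n, mulr1) /=.
  by apply; right.
(* (5/4, 3/4) and (5/4, -3/4) lie on x^2 - y^2 = 1.  If Q s s = Q t t, the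
   values of a^2 Q there would average to 17/8 in absolute value, although both
   are 1 or -1. *)
have pt : (5 / 4 : R) ^+ 2 - (3 / 4) ^+ 2 = 1 by field.
have pt' : (5 / 4 : R) ^+ 2 - (- (3 / 4)) ^+ 2 = 1 by field.
have qpt := on _ _ (or_introl pt); have qpt' := on _ _ (or_introl pt').
have sum0 : a ^+ 2 * (Q s s + Q t t) = 0.
  rewrite mulrDr; move: q10 q01 qpt qpt'; rewrite /=.
  move: (a ^+ 2 * Q s s) (a ^+ 2 * Q s t) (a ^+ 2 * Q t t) => A B C.
  by move=> [->|->] [->|->] [?|?] [?|?]; lra.
have := frame_trace ss tt st
    (coefL z n1 n2 p) (coefM z n1 n2 p) (coefN z n1 n2 p).
move/eqP: sum0; rewrite mulf_eq0 (negPf a20) /= => /eqP sum0.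
by rewrite -/Q sum0 mulr0.
Qed.

(** In a principal frame Q t t = - Q s s, so Q is Q s s (x^2 - y^2), which is a
rectangular hyperbola as soon as Q s s is nonzero; Q s s = 0 would make Q
vanish identically. *)
Lemma mixed_trace_rectangular : ~ flat_point z n1 n2 p ->
  mixed_trace z n1 n2 p = 0 ->
  rectangular_hyperbola z p [set w | Q w w = 1 \/ Q w w = -1].
Proof.
move=> nflat tr0; have [s [t [frame st0]]] := exists_principal_frame.
have [ss tt st] := frame.
have gram0 : gram z p != 0 by rewrite gt_eqF // (gram_gt0 hz Dp).
have Qtt : Q t t = - Q s s.
  have := frame_trace ss tt st
    (coefL z n1 n2 p) (coefM z n1 n2 p) (coefN z n1 n2 p).
  rewrite -/Q -/(gram z p) -/(mixed_trace z n1 n2 p) tr0 => /esym/eqP.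
  by rewrite mulf_eq0 (negPf gram0) /= addrC addr_eq0 => /eqP.
have Qw x y : Q (x *: s + y *: t) (x *: s + y *: t) = Q s s * (x ^+ 2 - y ^+ 2).
  by rewrite {1}/Q bform_lincomb -/Q st0 -/(Q t t) Qtt -/(Q s s); ring.
have nu0 : Q s s != 0.
  apply/eqP => nu0; apply: nflat.
  have Q0 g h : Q g h = 0.
    have [x [y ->]] := frame_span ss tt st g.
    have [x' [y' ->]] := frame_span ss tt st h.
    by rewrite /Q bform_lincomb -/Q Qtt nu0 st0; ring.
  split; [rewrite -(Q0 (1, 0) (1, 0))|rewrite -(Q0 (1, 0) (0, 1))|
    rewrite -(Q0 (0, 1) (0, 1))]; rewrite /Q /bform /=; ring.
pose a := (Num.sqrt `|Q s s|)^-1.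
have a0 : 0 < a by rewrite invr_gt0 sqrtr_gt0 normr_gt0.
have qE x y : x ^+ 2 / a ^+ 2 - y ^+ 2 / a ^+ 2 = `|Q s s| * (x ^+ 2 - y ^+ 2).
  by rewrite /a exprVn invrK sqr_sqrtr ?normr_ge0 //; ring.
have pm r : (`|Q s s| * r = 1 \/ `|Q s s| * r = -1) <->
    (Q s s * r = 1 \/ Q s s * r = -1).
  case: (ger0P (Q s s)) => _ //; rewrite mulNr.
  by move: (Q s s * r) => m; split=> -[] e; [right|left|right|left]; lra.
exists a, a; split=> //; split=> //; exists s, t; split=> //.
apply/seteqP; split=> w /=.
  have [x [y ->]] := frame_span ss tt st w; rewrite Qw => q.
  by exists x, y; split=> //; rewrite qE; apply/pm.
by move=> [x [y [-> q]]]; rewrite Qw; apply/pm; rewrite -qE.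
Qed.

End Indicatrix.

Theorem proposition3p6 (R : realType) (D : set (R * R))
    (z n1 n2 : R * R -> 'rV[R]_4)
    (hz : spacelike_surface D z)
    (hn : normal_frame D z n1 n2)
    (hflat : forall p : R * R, D p -> ~ flat_point z n1 n2 p) :
  flat_normal_connection D z <->
  (forall p : R * R, D p ->
     rectangular_hyperbola z p (tangent_indicatrix z n1 n2 p)).
Proof.
apply: iff_trans (flat_normal_connectionP hz hn) _.
split=> H p Dp; have := H p Dp; rewrite (tangent_indicatrixE n1 n2 hz Dp).
- exact: mixed_trace_rectangular hz Dp (hflat p Dp).
- exact: rectangular_mixed_trace.
Qed.
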